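(* Let $\Lambda=kQ/I$ be a Koszul quiver algebra with $\mathbb{K}$, $f^n_i$, $\varepsilon^n_i$ as in the context. Suppose that the cocycles $\eta:\mathbb{K}_n\rightarrow\Lambda$ and $\theta:\mathbb{K}_m\rightarrow\Lambda$ represent elements in $\mathrm{HH}^*(\Lambda)$ and that, for fixed $0\leq i\leq t_n$ and $0\leq j\leq t_m$, $\eta(\varepsilon^n_i)=\lambda_i$, $\eta(\varepsilon^n_l)=0$ for $l\neq i$, and $\theta(\varepsilon^m_j)=\lambda_j$, $\theta(\varepsilon^m_l)=0$ for $l\ne j$. Then the bracket $[\eta, \theta] : \mathbb{K}_{n+m-1}\rightarrow\Lambda$ has the property that, for every $0\le r\le t_{m+n-1}$, $$[\eta, \theta](\varepsilon^{m+n-1}_r) \in \begin{cases} kQ_1 &\text{if } \lambda_i=f^1_w\text{ and }\lambda_j=f^1_p, \\ kQ_2&\text{if }\lambda_i=f^1_{w}f^1_{w+1}\text{ and }\lambda_j=f^1_p, \\ kQ_3&\text{if }\lambda_i=f^1_{w}f^1_{w+1}\text{ and }\lambda_j=f^1_p f^1_{p+1}, \end{cases}$$ where $f^1_w,f^1_{w+1},f^1_p,f^1_{p+1}$ are paths of length $1$ and $kQ_l$ denotes the ($k$-span of the images in $\Lambda$ of the) paths of length $l$.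
   Context: $k$ is a field, $\otimes=\otimes_k$ unless indicated, $\Lambda=kQ/I$ is a graded Koszul quiver algebra ($Q$ a finite quiver, $I$ an admissible ideal, paths concatenated left to right), $\Lambda^e=\Lambda\otimes\Lambda^{op}$, and $o(x),t(x)$ denote the origin and terminal vertex (identified with the corresponding idempotents) of a uniform element $x$, i.e. a nonzero linear combination of paths with common origin and common terminus. Put $R=kQ$. There are integers $t_n$ and uniform elements $\{f^n_i\}_{i=0}^{t_n}\subset R$, $n\ge 0$ ($f^0_i$ the vertices, $f^1_i$ the arrows, $f^2_i$ uniform relations generating $I$), with $\cdots\subseteq\bigoplus_i f^n_iR\subseteq\bigoplus_i f^{n-1}_iR\subseteq\cdots\subseteq R$, such that $\mathbb{L}_n=\bigoplus_i f^n_iR/\bigoplus_i f^n_iI$ with differentials induced by the inclusions is a minimal projective resolution of $\Lambda_0$ as a right $\Lambda$-module, and there are scalars $c_{pq}(n,i,r)$ with $$f^n_i=\sum_{p=0}^{t_r}\sum_{q=0}^{t_{n-r}}c_{pq}(n,i,r)f^r_pf^{n-r}_q\qquad(0\le r\le n).$$ These are fixed. The minimal projective $\Lambda^e$-resolution $\mathbb{K}\to\Lambda$ is $\mathbb{K}_n=\bigoplus_{i=0}^{t_n}\Lambda o(f^n_i)\otimes_k t(f^n_i)\Lambda$, with generators $\varepsilon^n_i=(0,\dots,0,o(f^n_i)\otimes_k t(f^n_i),0,\dots,0)$ ($i$-th position), and $$d_n(\varepsilon^n_i)=\sum_{j=0}^{t_{n-1}}\Big(\sum_{p=0}^{t_1}c_{p,j}(n,i,1)f^1_p\varepsilon^{n-1}_j+(-1)^n\sum_{q=0}^{t_1}c_{j,q}(n,i,n-1)\varepsilon^{n-1}_jf^1_q\Big),$$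 where $f^1_p$ also denotes its residue class in $\Lambda$; the augmentation $\mu=d_0:\mathbb{K}_0\to\Lambda$ is multiplication. A cocycle is a $\Lambda^e$-map $\eta:\mathbb{K}_n\to\Lambda$ with $\eta d_{n+1}=0$. The diagonal map is $$\Delta_{\mathbb{K}}(\varepsilon^n_r)=\sum_{v=0}^n\sum_{p=0}^{t_v}\sum_{q=0}^{t_{n-v}}c_{p,q}(n,r,v)\,\varepsilon^v_p\otimes_\Lambda\varepsilon^{n-v}_q .$$ For $\eta:\mathbb{K}_n\to\Lambda$ (extended by zero to other degrees), $(\eta\otimes 1)(x\otimes y)=\eta(x)y$ and $(1\otimes\eta)(x\otimes y)=(-1)^{n|x|}x\,\eta(y)$. A homotopy lifting map of a cocycle $\eta:\mathbb{K}_n\to\Lambda$ is a $\Lambda^e$-module map $\psi_\eta:\mathbb{K}_m\to\mathbb{K}_{m-n+1}$ (all $m$) with $d\psi_\eta-(-1)^{n-1}\psi_\eta d=(\eta\otimes1-1\otimes\eta)\Delta_{\mathbb{K}}$ and $\psi_\eta|_{\mathbb{K}_{n-1}}=0$. The Gerstenhaber bracket is represented by $[\eta,\theta]=\eta\psi_\theta-(-1)^{(m-1)(n-1)}\theta\psi_\eta$, where $\psi_\eta,\psi_\theta$ are homotopy lifting maps. The homotopy liftings used are those of the paper: for a cocycle $\eta:\mathbb K_n\to\Lambda$ sending one generator to $f^1_w$ and the others to $0$, $\psi_\eta(\varepsilon^l_r)=b_{l,r}(l-n+1,s)\varepsilon^{l-n+1}_s$; for one sending one generator to $f^1_wf^1_{w+1}$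 and the others to $0$, $\psi_\eta(\varepsilon^l_r)=b_{l,r}(l-n+1,s+1)f^1_w\varepsilon^{l-n+1}_{s+1}+b_{l,r}(l-n+1,s)\varepsilon^{l-n+1}_sf^1_{w+1}$; here $s$ depends on $l,r$ and the $b$'s are scalars. *)

(* Defs.v *)
From HB Require Import structures.
From mathcomp Require Import all_boot all_algebra.
From mathcomp Require Import generic_quotient ring_quotient.
From mathcomp Require Import boolp functions.
From mathcomp Require Import freeg.
Set Implicit Arguments. Unset Strict Implicit. Unset Printing Implicit Defensive.
Import GRing.Theory.
Local Open Scope ring_scope.

(* A finite quiver; it is nonempty because kQ must be a nonzero ring. *)
Record quiver := Quiver {
  vertex :> finType;
  arrow : finType;
  src : arrow -> vertex;
  tgt : arrow -> vertex;
  vertex_inh : (0 < #|vertex|)%N }.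

Section PathAlgebra.
Variables (k : fieldType) (Q : quiver).

(* A path is a pair (v, s): its origin v and the sequence s of its arrows,
   read from left to right; the trivial path at v is (v, [::]). *)
Fixpoint is_path (v : Q) (s : seq (arrow Q)) : bool :=
  if s is a :: s' then (src a == v) && is_path (tgt a) s' else true.

Definition path_end (v : Q) (s : seq (arrow Q)) : Q := last v (map (@tgt Q) s).

(* Since Q is finite, a function on paths has finite support if and only if
   it vanishes on all sufficiently long paths. *)
Definition finite_path_support : {pred Q * seq (arrow Q) -> k^o} :=
  fun f => `[< (forall p, ~~ is_path p.1 p.2 -> f p = 0) /\
               exists n, forall p, (n <= size p.2)%N -> f p = 0 >].

Lemma finite_path_support_closed : submod_closed finite_path_support.
Proof.
split; first by apply/asboolP; split=> [//|]; exists 0%N.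
move=> c f g /asboolP[f0 [m fm]] /asboolP[g0 [n gn]]; apply/asboolP.
have E p : (c *: f + g) p = c * f p + g p by [].
split=> [p pP|]; first by rewrite E f0 // g0 // mulr0 addr0.
exists (maxn m n) => p; rewrite geq_max => /andP[mp np].
by rewrite E fm // gn // mulr0 addr0.
Qed.

HB.instance Definition _ :=
  GRing.isSubmodClosed.Build k (Q * seq (arrow Q) -> k^o) finite_path_support
    finite_path_support_closed.

Record path_alg := PathAlg {
  pcoef :> Q * seq (arrow Q) -> k^o;
  _ : pcoef \in finite_path_support }.

HB.instance Definition _ := [isSub for pcoef].
HB.instance Definition _ := [Choice of path_alg by <:].
HB.instance Definition _ := [SubChoice_isSubLmodule of path_alg by <:].

Implicit Types f g h : path_alg.

Lemma path_algP f g : (forall v s, f (v, s) = g (v, s)) -> f = g.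
Proof. by move=> fg; apply/val_inj/funext => -[v s]; apply: fg. Qed.

Lemma pcoef_path f v s : ~~ is_path v s -> f (v, s) = 0.
Proof. by move=> vs; case: f => f /= /asboolP[/(_ (v, s) vs)]. Qed.

Lemma pcoefD f g p : (f + g) p = f p + g p. Proof. by []. Qed.
Lemma pcoefZ c f p : (c *: f) p = c * f p. Proof. by []. Qed.

(* The coefficient of p in f * g: sum over all factorisations p = p' p''. *)
Definition pconv (f : seq (arrow Q) -> k) (g : Q * seq (arrow Q) -> k)
    (v : Q) (s : seq (arrow Q)) : k :=
  \sum_(i < (size s).+1) f (take i s) * g (path_end v (take i s), drop i s).

Lemma pconv_nil (f : seq (arrow Q) -> k) (g : Q * seq (arrow Q) -> k) v : pconv f g v [::] = f [::] * g (v, [::]).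
Proof. by rewrite /pconv big_ord1. Qed.

Lemma pconv_cons (f : seq (arrow Q) -> k) (g : Q * seq (arrow Q) -> k) v a s :
  pconv f g v (a :: s) =
  f [::] * g (v, a :: s) + pconv (fun s' => f (a :: s')) g (tgt a) s.
Proof. by rewrite /pconv big_ord_recl. Qed.

Lemma pconvDl (f f' : seq (arrow Q) -> k) (g : Q * seq (arrow Q) -> k) v s :
  pconv (fun s => f s + f' s) g v s = pconv f g v s + pconv f' g v s.
Proof. by rewrite /pconv -big_split; apply: eq_bigr => i _; rewrite mulrDl. Qed.

Lemma pconvZl c (f : seq (arrow Q) -> k) (g : Q * seq (arrow Q) -> k) v s :
  pconv (fun s => c * f s) g v s = c * pconv f g v s.
Proof. by rewrite /pconv big_distrr; apply: eq_bigr => i _; rewrite -mulrA. Qed.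

Lemma pconvA (f : seq (arrow Q) -> k) (g h : Q * seq (arrow Q) -> k) v s :
  pconv (pconv f g v) h v s = pconv f (fun p => pconv (fun s' => g (p.1, s')) h p.1 p.2) v s.
Proof.
elim: s f v => [|a s IH] f v; first by rewrite !pconv_nil /= ?pconv_nil mulrA.
rewrite !pconv_cons pconv_nil /= ?pconv_cons mulrDr mulrA -addrA; congr (_ + _).
rewrite -IH -pconvZl -pconvDl.
by apply: eq_bigr => i _; rewrite pconv_cons.
Qed.

Lemma is_path_cat v s s' :
  is_path v (s ++ s') = is_path v s && is_path (path_end v s) s'.
Proof. by elim: s v => //= a s IH v; rewrite IH andbA. Qed.

Definition pmul_fun f g : Q * seq (arrow Q) -> k :=
  fun p => pconv (fun s => f (p.1, s)) g p.1 p.2.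

Lemma pmul_subproof f g : pmul_fun f g \in finite_path_support.
Proof.
apply/asboolP; split=> [[v s] /= vs|].
  rewrite /pmul_fun /pconv big1 // => i _.
  move: vs; rewrite -{1}(cat_take_drop i s) is_path_cat negb_and.
  by case/orP => /pcoef_path ->; rewrite ?mul0r ?mulr0.
have /asboolP[_ [m fm]] := valP f; have /asboolP[_ [n gn]] := valP g.
exists (m + n)%N => -[v s] /= mn; rewrite /pmul_fun /pconv big1 // => i _ /=.
have [mi|im] := leqP m i.
  rewrite fm ?mul0r //= size_take; case: ifP => // _.
  exact: leq_trans (leq_addr _ _) mn.
rewrite gn ?mulr0 //= size_drop leq_subRL; last by rewrite -ltnS.
by apply: leq_trans mn; rewrite leq_add2r ltnW.
Qed.
Definition pmul f g := PathAlg (pmul_subproof f g).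

Lemma pone_subproof :
  (fun p : Q * seq (arrow Q) => (p.2 == [::])%:R : k) \in finite_path_support.
Proof.
apply/asboolP; split=> [[v [|a s]] //|].
by exists 1%N => -[v [|a s]].
Qed.
Definition pone := PathAlg pone_subproof.

Lemma pmulA : associative pmul.
Proof. by move=> f g h; apply: path_algP => v s; symmetry; exact: pconvA. Qed.
Lemma pmul1 : left_id pone pmul.
Proof.
move=> f; apply: path_algP => v s; rewrite /= /pmul_fun /= /pconv big_ord_recl /=.
rewrite take0 drop0 mul1r big1 ?addr0 // => i _.
by case: s i => [|a s] [i] //= _; rewrite mul0r.
Qed.
Lemma pmulr1 : right_id pone pmul.
Proof.
move=> f; apply: path_algP => v s; rewrite /= /pmul_fun /= /pconv big_ord_recr /=.
rewrite take_size drop_size mulr1 big1 ?add0r // => i _.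
by rewrite -size_eq0 size_drop subn_eq0 leqNgt ltn_ord mulr0.
Qed.
Lemma pmulDl : left_distributive pmul +%R.
Proof. by move=> f g h; apply: path_algP => v s; exact: pconvDl. Qed.
Lemma pmulDr : right_distributive pmul +%R.
Proof.
move=> f g h; apply: path_algP => v s.
rewrite pcoefD /= /pmul_fun /= /pconv -big_split; apply: eq_bigr => i _.
exact: mulrDr.
Qed.
Lemma pone_neq0 : pone != 0.
Proof.
have /card_gt0P[v _] := vertex_inh Q.
by apply/eqP => /(congr1 (fun f : path_alg => f (v, [::]))) /eqP; rewrite oner_eq0.
Qed.

HB.instance Definition _ :=
  GRing.Zmodule_isNzRing.Build path_alg pmulA pmul1 pmulr1 pmulDl pmulDr pone_neq0.

Lemma pscaleAl (c : k) f g : c *: (f * g) = (c *: f) * g.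
Proof. by apply: path_algP => v s; rewrite pcoefZ; symmetry; exact: pconvZl. Qed.
HB.instance Definition _ := GRing.Lmodule_isLalgebra.Build k path_alg pscaleAl.

Lemma pscaleAr (c : k) f g : c *: (f * g) = f * (c *: g).
Proof.
apply: path_algP => v s; rewrite pcoefZ /= /pmul_fun /pconv big_distrr.
by apply: eq_bigr => i _; rewrite /= mulrCA.
Qed.
HB.instance Definition _ := GRing.Lalgebra_isAlgebra.Build k path_alg pscaleAr.

Lemma pdelta_subproof (p : Q * seq (arrow Q)) : is_path p.1 p.2 ->
  (fun q => (q == p)%:R : k) \in finite_path_support.
Proof.
move=> pP; apply/asboolP; split=> [q|].
  by case: eqP => // ->; rewrite pP.
exists (size p.2).+1 => q; case: eqP => // ->.
by rewrite ltnn.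
Qed.
Definition pbasis p (pP : is_path p.1 p.2) := PathAlg (pdelta_subproof pP).

Definition pvertex (v : Q) : path_alg := pbasis (p := (v, [::])) isT.
Lemma arrow_is_path (a : arrow Q) : is_path (src a) [:: a].
Proof. by rewrite /= eqxx. Qed.
Definition parrow (a : arrow Q) : path_alg := pbasis (p := (_, _)) (arrow_is_path a).

Lemma pvertexM v w : pvertex v * pvertex w = if v == w then pvertex v else 0.
Proof.
apply: path_algP => u s; rewrite [LHS]big_ord_recl /= take0 drop0 /= big1 ?addr0.
  rewrite -natrM mulnb !xpair_eqE /= eqxx andbT.
  case: (eqVneq v w) => [<-|vw]; first by rewrite /= !xpair_eqE andbA andbb.
  rewrite [RHS]/=; case: (eqVneq u v) => // ->.
  by rewrite (negPf vw).
move=> i _; rewrite xpair_eqE; case: s i => [|a s] [i] //= _.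
by rewrite andbF mul0r.
Qed.

(* x is a nonzero combination of paths from u to v. *)
Definition uniform (x : path_alg) (u v : Q) : Prop :=
  x <> 0 /\ forall w s, x (w, s) != 0 -> w = u /\ path_end w s = v.
End PathAlgebra.
(* lact is the left action of A, ract the right action of B. *)
Record bimodule (A B : pzRingType) := Bimodule {
  bcar :> zmodType;
  lact : A -> bcar -> bcar;
  ract : bcar -> B -> bcar;
  lactDr : forall a, {morph lact a : x y / x + y};
  lactDl : forall x, {morph lact^~ x : a b / a + b};
  lact1 : forall x, lact 1 x = x;
  lactA : forall a b x, lact (a * b) x = lact a (lact b x);
  ractDl : forall b, {morph ract^~ b : x y / x + y};
  ractDr : forall x, {morph ract x : a b / a + b};
  ract1 : forall x, ract x 1 = x;
  ractA : forall x a b, ract x (a * b) = ract (ract x a) b;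
  lract : forall a x b, ract (lact a x) b = lact a (ract x b) }.

Section BimoduleMaps.
Variables (A B : pzRingType) (M M' : bimodule A B).
Definition bimod_map (g : M -> M') : Prop :=
  [/\ {morph g : x y / x + y},
      forall a x, g (lact a x) = lact a (g x) &
      forall x b, g (ract x b) = ract (g x) b].
End BimoduleMaps.

Section Tensor.
Variables (A S B : pzRingType) (M : bimodule A S) (N : bimodule S B).

(* M (x)_S N: the free abelian group on M * N modulo the usual relations. *)
Let F := {freeg (M * N)}.
Let pure (x : M) (y : N) : F := << (x, y) >>.

Inductive tensor_relation : F -> Prop :=
| TensorDl x x' y :
    tensor_relation (pure (x + x') y - (pure x y + pure x' y))
| TensorDr x y y' :
    tensor_relation (pure x (y + y') - (pure x y + pure x y'))
| TensorMid x s y : tensor_relation (pure (ract x s) y - pure x (lact s y))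
| Tensor0 : tensor_relation 0
| TensorB u v :
    tensor_relation u -> tensor_relation v -> tensor_relation (u - v).

Definition tensor_null : {pred F} := fun u => `[< tensor_relation u >].

Lemma tensor_null_closed : zmod_closed tensor_null.
Proof.
split; first exact/asboolP/Tensor0.
by move=> u v /asboolP Ru /asboolP Rv; apply/asboolP/TensorB.
Qed.
HB.instance Definition _ := GRing.isZmodClosed.Build F tensor_null tensor_null_closed.

Local Notation tensor_quot := (Quotient.quot tensor_null).
Definition tensor_zmod : zmodType := tensor_quot.
Local Open Scope quotient_scope.
Definition tens (x : M) (y : N) : tensor_zmod := \pi_tensor_quot (pure x y).

(* The additive map on M (x)_S N sending x (x) y to b x y; this is its meaning
   (see tens_liftE, tens_liftD) only for balanced b. *)
Definition tens_lift (P : zmodType) (b : M -> N -> P) (u : tensor_zmod) : P :=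
  fglift (fun z : M * N => b z.1 z.2 : zmodule P) (repr u).

Definition balanced (P : zmodType) (b : M -> N -> P) : Prop :=
  [/\ forall y, {morph b^~ y : x x' / x + x'},
      forall x, {morph b x : y y' / y + y'} &
      forall x s y, b (ract x s) y = b x (lact s y)].

Section Lift.
Variables (P : zmodType) (b : M -> N -> P) (bP : balanced b).
Let g : F -> zmodule P := fglift (fun z : M * N => b z.1 z.2 : zmodule P).
Let gB u v : g (u - v) = g u - g v.
Proof. exact: lift_is_additive. Qed.
Let g0 : g 0 = 0.
Proof. by have := gB 0 0; rewrite subr0 => ->; exact: subrr. Qed.
Let gD u v : g (u + v) = g u + g v.
Proof.
have gN : g (- v) = - g v by rewrite -[- v in LHS]sub0r gB g0; exact: sub0r.
by rewrite -{1}[v]opprK gB gN; congr (_ + _); exact: opprK.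
Qed.
Let gpure x y : g (pure x y) = b x y.
Proof. by rewrite /g /pure liftU scale1r. Qed.
Let g_null u : tensor_relation u -> g u = 0.
Proof.
case: bP => bDl bDr bM.
elim=> [x x' y|x y y'|x s y||{}u v _ Hu _ Hv].
- rewrite gB gD !gpure bDl; exact: subrr.
- rewrite gB gD !gpure bDr; exact: subrr.
- rewrite gB !gpure bM; exact: subrr.
- exact: g0.
- by rewrite gB Hu Hv subr0.
Qed.
Let lift_pi u : tens_lift b (\pi_tensor_quot u) = g u.
Proof.
apply/eqP; rewrite -subr_eq0 -gB; apply/eqP/g_null/asboolP.
rewrite -[`[<_>]]/(repr (\pi_tensor_quot u) - u \in tensor_null).
by rewrite Quotient.idealrBE reprK.
Qed.

Lemma tens_liftE x y : tens_lift b (tens x y) = b x y.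
Proof. by rewrite lift_pi gpure. Qed.

Lemma tens_liftD : {morph tens_lift b : u v / u + v}.
Proof.
move=> u v; rewrite -[u]reprK -[v]reprK.
by rewrite -[in LHS]pi_addr !lift_pi gD.
Qed.
End Lift.

Lemma tensDl y : {morph tens^~ y : x x' / x + x'}.
Proof.
move=> x x'; rewrite /tens -pi_addr; apply/eqP.
by rewrite -Quotient.idealrBE; apply/asboolP/TensorDl.
Qed.
Lemma tensDr x : {morph tens x : y y' / y + y'}.
Proof.
move=> y y'; rewrite /tens -pi_addr; apply/eqP.
by rewrite -Quotient.idealrBE; apply/asboolP/TensorDr.
Qed.
Lemma tens_mid x s y : tens (ract x s) y = tens x (lact s y).
Proof.
apply/eqP; rewrite -Quotient.idealrBE; exact/asboolP/TensorMid.
Qed.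

Lemma morphD_B (U V : zmodType) (h : U -> V) : {morph h : x y / x + y} ->
  {morph h : x y / x - y}.
Proof.
move=> hD x y; apply: (addIr (h y)); rewrite -hD !subrK //.
Qed.

Lemma tens_ext (P : zmodType) (h h' : tensor_zmod -> P) :
  {morph h : u v / u + v} -> {morph h' : u v / u + v} ->
  (forall x y, h (tens x y) = h' (tens x y)) -> h =1 h'.
Proof.
move=> hD h'D hh'.
have [hB h'B] := (morphD_B hD, morphD_B h'D).
have E0 : h 0 = h' 0 by rewrite -[0](subrr 0) hB h'B !subrr.
move=> u; rewrite -[u]reprK -[repr u]freeg_sumE.
elim: (dom _) => [|z r IH]; first by rewrite big_nil pi_zeror.
rewrite big_cons pi_addr hD h'D IH; congr (_ + _).
set c := coeff z _; clearbody c; case: z => x y.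
have nat_case n : h (\pi_tensor_quot << n%:Z *g (x, y) >>) = h' (\pi_tensor_quot << n%:Z *g (x, y) >>).
  elim: n => [|n IHn]; first by rewrite freegU0 pi_zeror.
  by rewrite -addn1 PoszD -freegUD pi_addr hD h'D IHn hh'.
case: c => [n|n]; first exact: nat_case.
by rewrite NegzE -freegUN -[- _]sub0r pi_addr pi_oppr pi_zeror hB h'B nat_case E0.
Qed.

Definition tens_lact (a : A) : tensor_zmod -> tensor_zmod :=
  tens_lift (fun x y => tens (lact a x) y).
Definition tens_ract (u : tensor_zmod) (b : B) : tensor_zmod :=
  tens_lift (fun x y => tens x (ract y b)) u.

Lemma tens_lact_balanced a : balanced (fun x y => tens (lact a x) y).
Proof.
split=> [y x x'|x y y'|x s y]; first by rewrite lactDr tensDl.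
  exact: tensDr.
by rewrite -lract tens_mid.
Qed.
Lemma tens_ract_balanced b : balanced (fun x y => tens x (ract y b)).
Proof.
split=> [y x x'|x y y'|x s y]; first exact: tensDl.
  by rewrite ractDl tensDr.
by rewrite lract tens_mid.
Qed.
Lemma tens_lactE a x y : tens_lact a (tens x y) = tens (lact a x) y.
Proof. exact: tens_liftE (tens_lact_balanced a) x y. Qed.
Lemma tens_ractE x y b : tens_ract (tens x y) b = tens x (ract y b).
Proof. exact: tens_liftE (tens_ract_balanced b) x y. Qed.
Lemma tens_lactDr a : {morph tens_lact a : u v / u + v}.
Proof. exact: tens_liftD (tens_lact_balanced a). Qed.
Lemma tens_ractDl b : {morph tens_ract^~ b : u v / u + v}.
Proof. exact: tens_liftD (tens_ract_balanced b). Qed.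

Lemma tens_lactDl u : {morph tens_lact^~ u : a b / a + b}.
Proof.
move=> a b; apply: (tens_ext (h := tens_lact (a + b))
                             (h' := fun v => tens_lact a v + tens_lact b v)).
- exact: tens_lactDr.
- by move=> v w; rewrite !tens_lactDr addrACA.
- by move=> x y; rewrite !tens_lactE lactDl tensDl.
Qed.
Lemma tens_ractDr u : {morph tens_ract u : a b / a + b}.
Proof.
move=> a b; apply: (tens_ext (h := tens_ract^~ (a + b))
                             (h' := fun v => tens_ract v a + tens_ract v b)).
- exact: tens_ractDl.
- by move=> v w; rewrite !tens_ractDl addrACA.
- by move=> x y; rewrite !tens_ractE ractDr tensDr.
Qed.
Lemma tens_lact1 u : tens_lact 1 u = u.
Proof.
apply: (tens_ext (h' := id)) => //; first exact: tens_lactDr.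
by move=> x y; rewrite tens_lactE lact1.
Qed.
Lemma tens_ract1 u : tens_ract u 1 = u.
Proof.
apply: (tens_ext (h := tens_ract^~ 1) (h' := id)) => //; first exact: tens_ractDl.
by move=> x y; rewrite tens_ractE ract1.
Qed.
Lemma tens_lactA a b u : tens_lact (a * b) u = tens_lact a (tens_lact b u).
Proof.
apply: (tens_ext (h' := fun v => tens_lact a (tens_lact b v))).
- exact: tens_lactDr.
- by move=> v w; rewrite !tens_lactDr.
- by move=> x y; rewrite !tens_lactE lactA.
Qed.
Lemma tens_ractA u a b : tens_ract u (a * b) = tens_ract (tens_ract u a) b.
Proof.
apply: (tens_ext (h := tens_ract^~ (a * b))
                 (h' := fun v => tens_ract (tens_ract v a) b)).
- exact: tens_ractDl.
- by move=> v w; rewrite !tens_ractDl.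
- by move=> x y; rewrite !tens_ractE ractA.
Qed.
Lemma tens_lract a u b :
  tens_ract (tens_lact a u) b = tens_lact a (tens_ract u b).
Proof.
apply: (tens_ext (h := fun v => tens_ract (tens_lact a v) b)
                 (h' := fun v => tens_lact a (tens_ract v b))).
- by move=> v w; rewrite tens_lactDr tens_ractDl.
- by move=> v w; rewrite tens_ractDl tens_lactDr.
- by move=> x y; rewrite tens_lactE !tens_ractE tens_lactE.
Qed.

Definition tensor : bimodule A B :=
  Bimodule tens_lactDr tens_lactDl tens_lact1 tens_lactA
           tens_ractDl tens_ractDr tens_ract1 tens_ractA tens_lract.
End Tensor.

(* Finite direct sums, as products. *)
Section DirectSum.
Variables (A B : pzRingType) (I : finType) (M : I -> bimodule A B).

Definition dsum : Type := forall i, M i.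
HB.instance Definition _ := Choice.on dsum.

Let dext (x y : dsum) : (forall i, x i = y i) -> x = y.
Proof. exact: functional_extensionality_dep. Qed.
Let dadd (x y : dsum) : dsum := fun i => x i + y i.
Let dopp (x : dsum) : dsum := fun i => - x i.
Let dzero : dsum := fun i => 0.
Fact dsum_addA : associative dadd.
Proof. by move=> x y z; apply: dext => i; apply: addrA. Qed.
Fact dsum_addC : commutative dadd.
Proof. by move=> x y; apply: dext => i; apply: addrC. Qed.
Fact dsum_add0 : left_id dzero dadd.
Proof. by move=> x; apply: dext => i; apply: add0r. Qed.
Fact dsum_addN : left_inverse dzero dopp dadd.
Proof. by move=> x; apply: dext => i; apply: addNr. Qed.
HB.instance Definition _ :=
  GRing.isZmodule.Build dsum dsum_addA dsum_addC dsum_add0 dsum_addN.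

Definition direct_sum : bimodule A B.
Proof.
refine (@Bimodule A B dsum (fun a x i => lact a (x i)) (fun x b i => ract (x i) b)
          _ _ _ _ _ _ _ _ _).
- by move=> a x y; apply: dext => i; apply: lactDr.
- by move=> x a b; apply: dext => i; apply: lactDl.
- by move=> x; apply: dext => i; apply: lact1.
- by move=> a b x; apply: dext => i; apply: lactA.
- by move=> b x y; apply: dext => i; apply: ractDl.
- by move=> x a b; apply: dext => i; apply: ractDr.
- by move=> x; apply: dext => i; apply: ract1.
- by move=> x a b; apply: dext => i; apply: ractA.
- by move=> a x b; apply: dext => i; apply: lract.
Defined.
End DirectSum.

Section RegularBimodule.
Variables (A : pzRingType).
Definition regular_bimod : bimodule A A :=
  @Bimodule A A A *%R *%R (fun a => mulrDr a) (fun x a b => mulrDl a b x)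
    (@mul1r A) (fun a b x => esym (mulrA a b x)) (fun b x y => mulrDl x y b)
    (fun x => mulrDr x) (@mulr1 A) (@mulrA A) (fun a x b => esym (mulrA a x b)).
End RegularBimodule.

(* A e = {x | x e = x} and e A = {x | e x = x} for an idempotent e. *)
Section IdempotentPart.
Variables (k : fieldType) (A : algType k) (e : A).

Definition in_left_part : {pred A} := fun x => x * e == x.
Definition in_right_part : {pred A} := fun x => e * x == x.
Lemma left_part_closed : submod_closed in_left_part.
Proof.
split; first by apply/eqP; rewrite mul0r.
move=> c x y /eqP xe /eqP ye; apply/eqP.
by rewrite mulrDl -scalerAl xe ye.
Qed.
Lemma right_part_closed : submod_closed in_right_part.
Proof.
split; first by apply/eqP; rewrite mulr0.
move=> c x y /eqP xe /eqP ye; apply/eqP.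
by rewrite mulrDr -scalerAr xe ye.
Qed.
HB.instance Definition _ :=
  GRing.isSubmodClosed.Build k A in_left_part left_part_closed.
HB.instance Definition _ :=
  GRing.isSubmodClosed.Build k A in_right_part right_part_closed.

Record left_part := LeftPart { lp_val : A; _ : lp_val \in in_left_part }.
HB.instance Definition _ := [isSub for lp_val].
HB.instance Definition _ := [Choice of left_part by <:].
HB.instance Definition _ := [SubChoice_isSubLmodule of left_part by <:].

Record right_part := RightPart { rp_val : A; _ : rp_val \in in_right_part }.
HB.instance Definition _ := [isSub for rp_val].
HB.instance Definition _ := [Choice of right_part by <:].
HB.instance Definition _ := [SubChoice_isSubLmodule of right_part by <:].

Lemma left_part_mul a (x : left_part) : a * val x \in in_left_part.
Proof. by apply/eqP; rewrite -mulrA (eqP (valP x)). Qed.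
Lemma right_part_mul (x : right_part) a : val x * a \in in_right_part.
Proof. by apply/eqP; rewrite mulrA (eqP (valP x)). Qed.

Definition left_bimod : bimodule A k.
Proof.
refine (@Bimodule A k left_part (fun a x => LeftPart (left_part_mul a x))
          (fun x c => c *: x) _ _ _ _ _ _ _ _ _).
- by move=> a x y; apply/val_inj/mulrDr.
- by move=> x a b; apply/val_inj/mulrDl.
- by move=> x; apply/val_inj/mul1r.
- by move=> a b x; apply/val_inj; rewrite /= mulrA.
- by move=> b x y; apply: scalerDr.
- by move=> x a b; apply: scalerDl.
- by move=> x; apply: scale1r.
- by move=> x a b; rewrite scalerA mulrC.
- by move=> a x b; apply/val_inj; apply: scalerAr.
Defined.

Definition right_bimod : bimodule k A.
Proof.
refine (@Bimodule k A right_part (fun c x => c *: x)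
          (fun x a => RightPart (right_part_mul x a)) _ _ _ _ _ _ _ _ _).
- by move=> a x y; apply: scalerDr.
- by move=> x a b; apply: scalerDl.
- by move=> x; apply: scale1r.
- by move=> a b x; rewrite scalerA.
- by move=> a x y; apply/val_inj/mulrDl.
- by move=> x a b; apply/val_inj/mulrDr.
- by move=> x; apply/val_inj/mulr1.
- by move=> x a b; apply/val_inj; rewrite /= mulrA.
- by move=> a x b; apply/val_inj; rewrite /= scalerAl.
Defined.
End IdempotentPart.

(* Right A-modules are left modules over the converse ring A^c. *)
Notation rmodType A := (lmodType (A : pzRingType)^c).
Definition racts (A : pzRingType) (M : rmodType A) (x : M) (a : A) : M :=
  (a : A^c) *: x.
Notation "x '*r' a" := (racts x a) (at level 40, left associativity).

Section GradedModules.

Definition grading (M : zmodType) (G : nat -> M -> Prop) : Prop :=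
  [/\ forall i, G i 0 /\ forall x y, G i x -> G i y -> G i (x - y),
      forall x, exists n (y : nat -> M), (forall i, G i (y i)) /\ x = \sum_(i < n) y i &
      forall n (y : nat -> M), (forall i, G i (y i)) -> \sum_(i < n) y i = 0 ->
        forall i, (i < n)%N -> y i = 0].

Variables (k : fieldType) (A : algType k) (G : nat -> A -> Prop).

Definition graded_algebra : Prop :=
  [/\ grading G, forall i c x, G i x -> G i (c *: x), G 0%N 1 &
      forall i j x y, G i x -> G j y -> G (i + j)%N (x * y)].

Definition positive_part (x : A) : Prop :=
  exists n (y : nat -> A), (forall i, G i.+1 (y i)) /\ x = \sum_(i < n) y i.

Definition graded_module (M : rmodType A) (H : nat -> M -> Prop) : Prop :=
  grading H /\ forall i j x a, H i x -> G j a -> H (i + j)%N (x *r a).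

(* The map q exhibits S as the quotient A_0 = A / A_+, as a right A-module. *)
Definition degree0_quotient (S : rmodType A) (q : A -> S) : Prop :=
  [/\ forall x y, q (x + y) = q x + q y,
      forall x a, q (x * a) = q x *r a,
      forall s, exists x, q x = s &
      forall x, q x = 0 <-> positive_part x].

Definition projective (P : rmodType A) : Prop :=
  forall (X Y : rmodType A) (g : {linear X -> Y}) (h : {linear P -> Y}),
    (forall y, exists x, g x = y) ->
    exists l : {linear P -> X}, forall p, g (l p) = h p.

Definition projective_resolution (S : rmodType A) (P : nat -> rmodType A)
    (d : forall n, {linear P n.+1 -> P n}) (aug : {linear P 0%N -> S}) : Prop :=
  [/\ forall n, projective (P n),
      forall s, exists x, aug x = s,
      forall x, aug x = 0 <-> exists y, d 0%N y = x &
      forall n x, d n x = 0 <-> exists y, d n.+1 y = x].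

Definition superfluous (M : rmodType A) (U : M -> Prop) : Prop :=
  forall V : M -> Prop,
    V 0 -> (forall x y, V x -> V y -> V (x - y)) -> (forall x a, V x -> V (x *r a)) ->
    (forall x, exists u v, [/\ U u, V v & x = u + v]) -> forall x, V x.

(* Minimality: every P n is a projective cover of its image. *)
Definition minimal_projective_resolution (S : rmodType A) (P : nat -> rmodType A)
    (d : forall n, {linear P n.+1 -> P n}) (aug : {linear P 0%N -> S}) : Prop :=
  projective_resolution d aug /\
  forall n, superfluous (fun x => exists y, d n y = x).

Definition koszul_algebra : Prop :=
  graded_algebra /\
  exists (S : rmodType A) (q : A -> S) (P : nat -> rmodType A)
         (d : forall n, {linear P n.+1 -> P n}) (aug : {linear P 0%N -> S})
         (H : forall n, nat -> P n -> Prop),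
    [/\ degree0_quotient q, projective_resolution d aug,
        forall n, graded_module (H n),
        (forall n i x, H n.+1 i x -> H n i (d n x)) /\
        (forall i x, H 0%N i.+1 x -> aug x = 0) &
        forall n x, exists m (y : nat -> P n) (a : nat -> A),
          (forall i, H n n (y i)) /\ x = \sum_(i < m) y i *r a i].
End GradedModules.

Section QuiverAlgebra.
Variables (k : fieldType) (Q : quiver) (Lambda : algType k).
Local Notation R := (path_alg k Q).
Variable pi : {lrmorphism R -> Lambda}.

(* The span of the images in Lambda of the paths of length l. *)
Definition kQ_ (l : nat) (y : Lambda) : Prop :=
  exists2 x : R, (forall p, size p.2 != l -> x p = 0) & pi x = y.

(* J^m, for J the arrow ideal, is spanned by the paths of length at least m. *)
Definition arrow_ideal_power (m : nat) (x : R) : Prop :=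
  forall p, (size p.2 < m)%N -> x p = 0.

(* Lambda = kQ/I, where I = ker pi satisfies J^m <= I <= J^2 for some m >= 2. *)
Definition quiver_algebra : Prop :=
  [/\ forall y, exists x, pi x = y,
      forall x, pi x = 0 -> arrow_ideal_power 2 x &
      exists2 m, (2 <= m)%N & forall x, arrow_ideal_power m x -> pi x = 0].

(* N n = t_n + 1 is the number of elements f^n_i; it may be 0. *)
Variables (N : nat -> nat) (f : nat -> nat -> R) (o t : nat -> nat -> Q).

(* sum_i f^n_i R and sum_i f^n_i I *)
Definition fR n (x : R) : Prop :=
  exists r : nat -> R, x = \sum_(i < N n) f n i * r i.
Definition fI n (x : R) : Prop :=
  exists2 r : nat -> R, (forall i, pi (r i) = 0) & x = \sum_(i < N n) f n i * r i.

(* kappa n : fR n -> L n exhibits L n as the quotient fR n / fI n; the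
   differential of L is induced by the inclusion of fR n.+1 in fR n. *)
Definition minimal_resolution_from_f : Prop :=
  exists (S : rmodType Lambda) (q : Lambda -> S) (L : nat -> rmodType Lambda)
         (dL : forall n, {linear L n.+1 -> L n}) (aug : {linear L 0%N -> S})
         (kappa : forall n, R -> L n),
    [/\ degree0_quotient kQ_ q, minimal_projective_resolution dL aug,
        forall n, [/\ forall x y, fR n x -> fR n y -> kappa n (x + y) = kappa n x + kappa n y,
                      forall x r, fR n x -> kappa n (x * r) = kappa n x *r pi r,
                      forall z, exists2 x, fR n x & kappa n x = z &
                      forall x, fR n x -> (kappa n x = 0 <-> fI n x)],
        forall n x, fR n.+1 x -> dL n (kappa n.+1 x) = kappa n x &
        forall x, aug (kappa 0%N x) = q (pi x)].

Record resolution_data (c : nat -> nat -> nat -> nat -> nat -> k) : Prop := {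
  f_uniform : forall n i, (i < N n)%N -> uniform (f n i) (o n i) (t n i);
  f0_vertices : perm_eq (mkseq (f 0%N) (N 0%N)) [seq pvertex k v | v <- enum Q];
  f1_arrows : perm_eq (mkseq (f 1%N) (N 1%N)) [seq parrow k a | a <- enum (arrow Q)];
  f2_generate : forall x, pi x = 0 <->
    exists m (a b : nat -> R) (s : nat -> nat),
      (forall j, (j < m)%N -> (s j < N 2)%N) /\ x = \sum_(j < m) a j * f 2 (s j) * b j;
  f_direct : forall n (r : nat -> R),
    \sum_(i < N n) f n i * r i = 0 -> forall i, (i < N n)%N -> f n i * r i = 0;
  f_decreasing : forall n x, fR n.+1 x -> fR n x;
  f_resolution : minimal_resolution_from_f;
  (* c p q n i r is the scalar c_{pq}(n,i,r) *)
  f_comult : forall n i r, (i < N n)%N -> (r <= n)%N ->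
    f n i = \sum_(p < N r) \sum_(q < N (n - r)) c p q n i r *: (f r p * f (n - r) q) }.

Lemma pi_vertex_left v : pi (pvertex k v) \in in_left_part (pi (pvertex k v)).
Proof. by apply/eqP; rewrite -rmorphM pvertexM eqxx. Qed.
Lemma pi_vertex_right v : pi (pvertex k v) \in in_right_part (pi (pvertex k v)).
Proof. by apply/eqP; rewrite -rmorphM pvertexM eqxx. Qed.

(* Lambda u (x)_k v Lambda, and its generator u (x) v *)
Definition vertex_bimod (u v : Q) : bimodule Lambda Lambda :=
  tensor (left_bimod (pi (pvertex k u))) (right_bimod (pi (pvertex k v))).
Definition vertex_gen (u v : Q) : vertex_bimod u v :=
  tens (M := left_bimod _) (N := right_bimod _)
    (LeftPart (pi_vertex_left u)) (RightPart (pi_vertex_right v)).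

Definition K (n : nat) : bimodule Lambda Lambda :=
  direct_sum (fun i : 'I_(N n) => vertex_bimod (o n i) (t n i)).

(* eps n i is the generator of K n; by convention it is 0 if i is not < N n. *)
Definition eps (n i : nat) : K n :=
  fun j => if val j == i then vertex_gen (o n j) (t n j) else 0.

Definition bscale (M : bimodule Lambda Lambda) (z : k) (x : M) : M := lact (z%:A) x.

End QuiverAlgebra.
Arguments eps {k Q Lambda} pi N o t n i.

Section HochschildComplex.
Variables (k : fieldType) (Q : quiver) (Lambda : algType k).
Variable pi : {lrmorphism path_alg k Q -> Lambda}.
Variables (N : nat -> nat) (f : nat -> nat -> path_alg k Q) (o t : nat -> nat -> Q).
Variable c : nat -> nat -> nat -> nat -> nat -> k.
Local Notation KK := (K pi N o t).
Local Notation ee := (eps pi N o t).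
Local Notation f1 p := (pi (f 1 p)).
Local Notation "z *b x" := (bscale z x) (at level 40, left associativity).

(* A homogeneous map g on a graded module is given by its components
   g a b : K a -> K b, which vanish unless b is the degree to which g sends a. *)
Record is_differential (d : forall a b, KK a -> KK b) : Prop := {
  diff_map : forall a b, bimod_map (d a b);
  diff_degree : forall a b x, a <> b.+1 -> d a b x = 0;
  diff_eps : forall n i, (i < N n.+1)%N ->
    d n.+1 n (ee n.+1 i) =
    \sum_(j < N n)
      (\sum_(p < N 1) c p j n.+1 i 1 *b lact (f1 p) (ee n j) +
       (-1) ^+ n.+1 *b (\sum_(q < N 1) c j q n.+1 i n *b ract (ee n j) (f1 q))) }.

Local Notation KxK v w := (tensor (KK v) (KK w)).

(* D a v w is the component of D : K a -> (K (x)_Lambda K)_a in K v (x) K w. *)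
Record is_diagonal (D : forall a v w, KK a -> KxK v w) : Prop := {
  diag_map : forall a v w, bimod_map (D a v w);
  diag_degree : forall a v w x, (v + w)%N <> a -> D a v w x = 0;
  diag_eps : forall n r v, (r < N n)%N -> (v <= n)%N ->
    D n v (n - v)%N (ee n r) =
    \sum_(p < N v) \sum_(q < N (n - v))
      c p q n r v *b (tens (ee v p) (ee (n - v) q) : KxK v (n - v)) }.

Variable d : forall a b, KK a -> KK b.
Variable D : forall a v w, KK a -> KxK v w.
Arguments d : clear implicits.
Arguments D : clear implicits.

Definition cocycle n (eta : KK n -> regular_bimod Lambda) : Prop :=
  bimod_map eta /\ forall x, eta (d n.+1 n x) = 0.

(* eta (x) 1 and 1 (x) eta on the components where they can be nonzero *)
Definition eta_tens n (eta : KK n -> regular_bimod Lambda) b : KxK n b -> KK b :=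
  tens_lift (fun (x : KK n) (y : KK b) => lact (eta x) y).
Definition tens_eta n (eta : KK n -> regular_bimod Lambda) b : KxK b n -> KK b :=
  tens_lift (fun (x : KK b) (y : KK n) => (-1) ^+ (n * b) *b ract x (eta y)).

(* The sign (-1)^(n-1) is written (-1)^(n+1), to allow n = 0; the term
   psi (d x) is absent for a = 0, since then d a a.-1 = 0. *)
Record homotopy_lifting n (eta : KK n -> regular_bimod Lambda)
    (psi : forall a b, KK a -> KK b) : Prop := {
  lift_map : forall a b, bimod_map (psi a b);
  lift_degree : forall a b x, (b + n)%N <> a.+1 -> psi a b x = 0;
  lift_init : forall a b x, a.+1 = n -> psi a b x = 0;
  lift_homotopy : forall a b x, (b + n)%N = a ->
    d b.+1 b (psi a b.+1 x) - (-1) ^+ n.+1 *b psi a.-1 b (d a a.-1 x) =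
    eta_tens eta (D a n b x) - tens_eta eta (D a b n x) }.

(* [eta, theta] on K a, where a = m + n - 1; the exponent (m+1)(n+1) has the
   parity of (m-1)(n-1). *)
Definition gbracket n m (eta : KK n -> regular_bimod Lambda)
    (theta : KK m -> regular_bimod Lambda) (psi_eta psi_theta : forall a b, KK a -> KK b)
    a (x : KK a) : Lambda :=
  eta (psi_theta a n x) - (-1) ^+ (m.+1 * n.+1) * theta (psi_eta a m x).

(* The shape of psi_eta if eta sends one generator of K n to an arrow;
   below, l' stands for l - n + 1. *)
Definition arrow_lifting n (psi : forall a b, KK a -> KK b) : Prop :=
  exists (b : nat -> nat -> nat -> nat -> k) (s : nat -> nat -> nat),
    forall l r l', (r < N l)%N -> (l' + n)%N = l.+1 ->
      psi l l' (ee l r) = b l r l' (s l r) *b ee l' (s l r).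

(* The same if eta sends one generator of K n to f^1_w f^1_{w+1}. *)
Definition two_arrow_lifting n w (psi : forall a b, KK a -> KK b) : Prop :=
  exists (b : nat -> nat -> nat -> nat -> k) (s : nat -> nat -> nat),
    forall l r l', (r < N l)%N -> (l' + n)%N = l.+1 ->
      psi l l' (ee l r) =
        b l r l' (s l r).+1 *b lact (f1 w) (ee l' (s l r).+1) +
        b l r l' (s l r) *b ract (ee l' (s l r)) (f1 w.+1).
End HochschildComplex.

(* Main.v *)
(* An explicit homotopy lifting sends a generator to a combination of terms
   x e y, where e is a generator and the path lengths of x and y sum to 0 or 1.
   A cocycle concentrated on one generator with value a path of length l then
   maps such a term into kQ_l or kQ_{l+1}, and both summands of the bracket
   land in the same degree. *)

Require Import Defs.
From mathcomp Require Import all_boot all_algebra.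
From mathcomp Require Import boolp.
Set Implicit Arguments. Unset Strict Implicit. Unset Printing Implicit Defensive.
Import GRing.Theory.
Local Open Scope ring_scope.

Section PathLength.
Variables (k : fieldType) (Q : quiver) (Lambda : algType k).
Variable pi : {lrmorphism path_alg k Q -> Lambda}.

Lemma kQ_0 l : kQ_ pi l 0.
Proof. by exists 0; rewrite ?raddf0. Qed.

Lemma kQ_D l x y : kQ_ pi l x -> kQ_ pi l y -> kQ_ pi l (x + y).
Proof.
move=> [u ul <-] [v vl <-]; exists (u + v); last by rewrite raddfD.
by move=> p pl; rewrite pcoefD ul // vl // addr0.
Qed.

Lemma kQ_Z l z x : kQ_ pi l x -> kQ_ pi l (z *: x).
Proof.
move=> [u ul <-]; exists (z *: u); last by rewrite linearZ.
by move=> p pl; rewrite pcoefZ ul // mulr0.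
Qed.

(** Representatives multiply by convolution over the splittings of a path. If the whole path does
    not have length [l + l'], then in each splitting either the prefix has length other than [l] or
    the suffix has length other than [l'], so every term vanishes. *)
Lemma kQ_M l l' x y : kQ_ pi l x -> kQ_ pi l' y -> kQ_ pi (l + l') (x * y).
Proof.
move=> [u ul <-] [v vl' <-]; exists (u * v); last by rewrite rmorphM.
move=> [q s] /= sl; rewrite /pmul_fun /pconv big1 // => i _ /=.
have i_le : (i <= size s)%N by rewrite -ltnS.
have [il|il] := eqVneq (val i) l; last by rewrite ul ?mul0r //= size_takel.
rewrite vl' ?mulr0 //= size_drop; apply: contra sl => /eqP <-.
by rewrite -il subnKC.
Qed.

Lemma kQ_arrow a : kQ_ pi 1 (pi (parrow k a)).
Proof.
exists (parrow k a) => // -[v s] /= s1.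
by rewrite xpair_eqE; case: (s =P [:: a]) s1 => [->|_]; rewrite ?andbF.
Qed.

Variables (N : nat -> nat) (f : nat -> nat -> path_alg k Q) (o t : nat -> nat -> Q).

(** The elements [f 1 w] are the arrows only up to reordering, so membership in the list is
    transported along the permutation. *)
Lemma kQ_f1 c w : resolution_data pi N f o t c -> (w < N 1%N)%N ->
  kQ_ pi 1 (pi (f 1%N w)).
Proof.
move=> Hf wN; have : f 1%N w \in mkseq (f 1%N) (N 1%N).
  by apply: map_f; rewrite mem_iota.
by rewrite (perm_mem (f1_arrows Hf)) => /mapP[a _ ->]; exact: kQ_arrow.
Qed.

Variables (n : nat) (eta : K pi N o t n -> regular_bimod Lambda).
Hypothesis eta_map : bimod_map eta.

Lemma bimod_map_bscale z x : eta (bscale z x) = z *: (eta x : Lambda).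
Proof. by case: eta_map => _ etaL _; rewrite /bscale etaL /= -scalerAl mul1r. Qed.

Lemma eps_out i : (N n <= i)%N -> eps pi N o t n i = 0.
Proof.
move=> Ni; apply: functional_extensionality_dep => j; rewrite /eps.
by case: eqP => // ji; move: Ni; rewrite -ji leqNgt ltn_ord.
Qed.

(** The conclusion covers every natural number [s], since nothing bounds the indices chosen by a
    lifting; beyond [N n] the generator is 0 by convention. *)
Lemma kQ_eps l i lam : kQ_ pi l lam -> eta (eps pi N o t n i) = lam ->
  (forall s, (s < N n)%N -> s <> i -> eta (eps pi N o t n s) = 0) ->
  forall s, kQ_ pi l (eta (eps pi N o t n s)).
Proof.
move=> laml eta_i eta_l s; have [->|/eqP si] := eqVneq s i; first by rewrite eta_i.
have [sN|Ns] := ltnP s (N n); first by rewrite eta_l //; exact: kQ_0.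
rewrite eps_out //; case: eta_map => etaD _ _.
(* Additivity at [0 + 0] forces [eta 0 = 0]. *)
by have /eqP := etaD 0 0; rewrite addr0 addrC -subr_eq subrr => /eqP <-; exact: kQ_0.
Qed.

Variable psi : forall a b, K pi N o t a -> K pi N o t b.
Arguments psi : clear implicits.
Variables (l m a r : nat).
Hypothesis eta_eps : forall s, kQ_ pi l (eta (eps pi N o t n s)).
Hypotheses (Hr : (r < N a)%N) (Ha : (n + m)%N = a.+1).

(** The lifting yields a scalar multiple of one generator, so the length [l] is unchanged. *)
Lemma kQ_arrow_lifting : arrow_lifting m psi ->
  kQ_ pi l (eta (psi a n (eps pi N o t a r))).
Proof.
by move=> [b [s ->]] //; rewrite bimod_map_bscale; apply: kQ_Z.
Qed.

(** Each term carries one arrow, on the left or on the right. It comes out of [eta] by bilinearity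
    and raises the length by one. *)
Lemma kQ_two_arrow_lifting w :
  kQ_ pi 1 (pi (f 1%N w)) -> kQ_ pi 1 (pi (f 1%N w.+1)) ->
  two_arrow_lifting f m w psi -> kQ_ pi l.+1 (eta (psi a n (eps pi N o t a r))).
Proof.
move=> fw fw1 [b [s ->]] //; have [etaD etaL etaR] := eta_map.
rewrite etaD !bimod_map_bscale etaL etaR.
apply: kQ_D; apply: kQ_Z; first by rewrite -add1n; exact: kQ_M.
by rewrite -addn1; exact: kQ_M.
Qed.
End PathLength.

Theorem theorem4p20 (k : fieldType) (Q : quiver) (Lambda : algType k)
    (pi : {lrmorphism path_alg k Q -> Lambda})
    (HLambda : quiver_algebra pi) (HKoszul : koszul_algebra (kQ_ pi))
    (N : nat -> nat) (f : nat -> nat -> path_alg k Q) (o t : nat -> nat -> Q)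
    (c : nat -> nat -> nat -> nat -> nat -> k)
    (Hf : resolution_data pi N f o t c)
    (d : forall a b, K pi N o t a -> K pi N o t b)
    (Hd : is_differential f c d)
    (Delta : forall a v w, K pi N o t a -> tensor (K pi N o t v) (K pi N o t w))
    (HDelta : is_diagonal c Delta)
    (n m : nat)
    (eta : K pi N o t n -> regular_bimod Lambda)
    (theta : K pi N o t m -> regular_bimod Lambda)
    (Heta : cocycle d eta) (Htheta : cocycle d theta)
    (i j : nat) (Hi : (i < N n)%N) (Hj : (j < N m)%N)
    (lambda_i lambda_j : Lambda)
    (eta_i : eta (eps pi N o t n i) = lambda_i)
    (eta_l : forall l, (l < N n)%N -> l <> i -> eta (eps pi N o t n l) = 0)
    (theta_j : theta (eps pi N o t m j) = lambda_j)
    (theta_l : forall l, (l < N m)%N -> l <> j -> theta (eps pi N o t m l) = 0)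
    (psi_eta psi_theta : forall a b, K pi N o t a -> K pi N o t b)
    (Hpsi_eta : homotopy_lifting d Delta eta psi_eta)
    (Hpsi_theta : homotopy_lifting d Delta theta psi_theta)
    (a r : nat) (Ha : a.+1 = (m + n)%N) (Hr : (r < N a)%N) :
  let bracket := gbracket eta theta psi_eta psi_theta (eps pi N o t a r) in
  [/\ forall w p, (w < N 1)%N -> (p < N 1)%N ->
        lambda_i = pi (f 1%N w) -> lambda_j = pi (f 1%N p) ->
        arrow_lifting n psi_eta -> arrow_lifting m psi_theta ->
        kQ_ pi 1 bracket,
      forall w p, (w.+1 < N 1)%N -> (p < N 1)%N ->
        lambda_i = pi (f 1%N w) * pi (f 1%N w.+1) -> lambda_j = pi (f 1%N p) ->
        two_arrow_lifting f n w psi_eta -> arrow_lifting m psi_theta ->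
        kQ_ pi 2 bracket &
      forall w p, (w.+1 < N 1)%N -> (p.+1 < N 1)%N ->
        lambda_i = pi (f 1%N w) * pi (f 1%N w.+1) ->
        lambda_j = pi (f 1%N p) * pi (f 1%N p.+1) ->
        two_arrow_lifting f n w psi_eta -> two_arrow_lifting f m p psi_theta ->
        kQ_ pi 3 bracket].
Proof.
have [eta_map _] := Heta; have [theta_map _] := Htheta.
have mn : (m + n)%N = a.+1 by rewrite Ha.
have nm : (n + m)%N = a.+1 by rewrite addnC.
have bracketP l :
    kQ_ pi l (eta (psi_theta a n (eps pi N o t a r))) ->
    kQ_ pi l (theta (psi_eta a m (eps pi N o t a r))) ->
    kQ_ pi l (gbracket eta theta psi_eta psi_theta (eps pi N o t a r)).
  move=> Hx Hy; apply: kQ_D Hx _.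
  (* The bracket's sign is a power of -1 in [Lambda]; splitting on its parity turns it into scaling
     by elements of [k]. *)
  rewrite -signr_odd mulr_sign -scaleN1r; apply: kQ_Z.
  by case: ifP => _ //; rewrite -scaleN1r; exact: kQ_Z.
have F1 w : (w < N 1)%N -> kQ_ pi 1 (pi (f 1%N w)) by exact: kQ_f1 Hf.
have F2 w : (w.+1 < N 1)%N -> kQ_ pi 2 (pi (f 1%N w) * pi (f 1%N w.+1)).
  by move=> wN; apply: (kQ_M (F1 _ (ltnW wN)) (F1 _ wN)).
have eta_eps l : kQ_ pi l lambda_i -> forall s, kQ_ pi l (eta (eps pi N o t n s)).
  by move=> il; exact: (kQ_eps eta_map il eta_i eta_l).
have theta_eps l :
    kQ_ pi l lambda_j -> forall s, kQ_ pi l (theta (eps pi N o t m s)).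
  by move=> jl; exact: (kQ_eps theta_map jl theta_j theta_l).
(* Value length plus lifting increment, for the [eta] summand and then the [theta] summand: 1+0 and
   1+0, then 2+0 and 1+1, then 2+1 and 2+1. *)
split=> w p wN pN Ei Ej Leta Ltheta; apply: bracketP.
- by apply: kQ_arrow_lifting Ltheta => //; apply: eta_eps; rewrite Ei; exact: F1.
- by apply: kQ_arrow_lifting Leta => //; apply: theta_eps; rewrite Ej; exact: F1.
- by apply: kQ_arrow_lifting Ltheta => //; apply: eta_eps; rewrite Ei; exact: F2.
- apply: kQ_two_arrow_lifting Leta => //; [|exact/F1/ltnW|exact: F1].
  by apply: theta_eps; rewrite Ej; exact: F1.
- apply: kQ_two_arrow_lifting Ltheta => //; [|exact/F1/ltnW|exact: F1].
  by apply: eta_eps; rewrite Ei; exact: F2.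
- apply: kQ_two_arrow_lifting Leta => //; [|exact/F1/ltnW|exact: F1].
  by apply: theta_eps; rewrite Ej; exact: F2.
Qed.
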